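(* Let $m,n$ be positive integers with $2m+1<2n+1$. Let $2n+1=(2m+1)\ell+r$, where $0\le r\le 2m$ and $\ell\ge 1$ are integers, and let $\ell+r=2m\ell'+r'$, where $0\le r'<2m$ and $\ell'\ge 0$ are integers. If either $(r,r',\ell')\in\{i\mid 2\le i\le m\}\times\{j\mid 1\le j\le m\}\times\{0\}$ or $r\in\{1\}\cup\{i\mid m+2\le i\le 2m\}$, then $$\gamma_{\times 2,t}(H_{2m+1,2n+1})=\left\lceil \frac{4n+1}{2m+1}\right\rceil,$$ and otherwise $$\left\lceil \frac{4n+1}{2m+1}\right\rceil \le \gamma_{\times 2,t}(H_{2m+1,2n+1}) \le \left\lceil \frac{4n+1}{2m+1}\right\rceil +1.$$
   Context: All graphs are finite and simple; $N(x)$ denotes the open neighborhood of a vertex $x$. For a graph $G$ with minimum degree at least $2$, a subset $S\subseteq V(G)$ is a double total dominating set (2TDS) of $G$ if $|N(x)\cap S|\ge 2$ for every $x\in V(G)$. The double total domination number $\gamma_{\times 2,t}(G)$ is the minimum cardinality of a double total dominating set of $G$. Harary graph $H_{p,q}$ with $p,q$ both odd and $p<q$: index $q$ vertices, placed equally spaced around a circle, by the integers modulo $q$ in circular order. The graph $H_{p-1,q}$ is formed by making each vertex adjacent to the nearest $\frac{p-1}{2}$ vertices in each direction around the circle. Then $H_{p,q}$ is constructed from $H_{p-1,q}$ by adding the edges $i\leftrightarrow i+\frac{q-1}{2}$ for $0\le i\le \frac{q-1}{2}$. *)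

(* Defs.v *)
From mathcomp Require Import all_boot all_order all_algebra.
From mathcomp Require Import zify.

Set Implicit Arguments.
Unset Strict Implicit.
Unset Printing Implicit Defensive.

(* A graph on a finite vertex type [T] is given by its adjacency relation
   [e : rel T]; [harary_sym] and [harary_irrefl] below show that the Harary
   graphs are simple. *)

Definition nbhd (T : finType) (e : rel T) (x : T) : {set T} := [set y | e x y].

Definition double_total_dominating (T : finType) (e : rel T) (S : {set T}) :
    bool :=
  [forall x, 2 <= #|nbhd e x :&: S|].

(* When [e] has minimum degree at least 2, the whole vertex set is double total
   dominating ([double_total_dominatingT]), so the minimum is attained on
   a double total dominating set ([double_total_dominationP]); the value for
   other graphs is meaningless. *)
Definition double_total_domination (T : finType) (e : rel T) : nat :=
  #|[arg min_(S < [set: T] | double_total_dominating e S) #|S| ]|.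

(* The graph H_{d,q} for even d: each vertex of Z/q is adjacent to the d/2
   nearest vertices in each direction; the distance along the circle is k.+1
   with k < d/2. *)
Definition harary_even (d q : nat) : rel 'I_q := fun i j =>
  [exists k : 'I_d./2,
     (val j == (i + k.+1) %% q) || (val i == (j + k.+1) %% q)].

Definition harary_chord (q : nat) : rel 'I_q := fun i j =>
  (i <= (q - 1)./2) && (val j == (i + (q - 1)./2) %% q).

(* The graph H_{p,q} for p and q odd, p < q. *)
Definition harary (p q : nat) : rel 'I_q := fun i j =>
  [|| harary_even (p - 1) i j, harary_chord i j | harary_chord j i].

Lemma double_total_dominatingT (T : finType) (e : rel T) :
  double_total_dominating e [set: T] = [forall x, 2 <= #|nbhd e x|].
Proof. by apply: eq_forallb => x; rewrite setIT. Qed.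

Lemma double_total_dominationP (T : finType) (e : rel T) :
  (forall x, 2 <= #|nbhd e x|) ->
  (exists2 S, double_total_dominating e S & #|S| = double_total_domination e)
  /\ (forall S, double_total_dominating e S -> double_total_domination e <= #|S|).
Proof.
move=> deg2; rewrite /double_total_domination.
have dT : double_total_dominating e [set: T].
  by rewrite double_total_dominatingT; apply/forallP.
by case: arg_minnP => // S dS minS; split=> //; exists S.
Qed.

Lemma harary_sym (p q : nat) : symmetric (@harary p q).
Proof.
move=> i j; rewrite /harary [harary_chord i j || _]orbC; congr (_ || _).
by apply: eq_existsb => k; rewrite orbC.
Qed.

Lemma harary_irrefl (p q : nat) :
  1 < p -> p < q -> irreflexive (@harary p q).
Proof.
move=> p_gt1 ltpq i.
have shift k : 0 < k < q -> (val i == (i + k) %% q) = false.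
  case/andP=> k0 kq; apply/negP => /eqP E; have iq := ltn_ord i.
  have /eqP := etrans (modn_small iq) E.
  rewrite -{1}[val i]addn0 eqn_modDl mod0n modn_small //.
  by rewrite eq_sym (gtn_eqF k0).
rewrite /harary /harary_chord /= shift ?andbF ?orbF; last by lia.
apply/existsP => -[k]; have ltk := ltn_ord k.
by rewrite shift; lia.
Qed.

Lemma harary_min_degree (p q : nat) (x : 'I_q) :
  odd p -> 1 < p -> p < q -> 2 <= #|nbhd (@harary p q) x|.
Proof.
move=> oddp p_gt1 ltpq; have q0 : 0 < q by lia.
have d0 : 0 < (p - 1)./2 by lia.
pose y := Ordinal (ltn_pmod (x + 1) q0).
pose z := Ordinal (ltn_pmod (x + (q - 1)) q0).
have yN : y \in nbhd (@harary p q) x.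
  rewrite inE /harary; apply/orP; left.
  by apply/existsP; exists (Ordinal d0); rewrite /= eqxx.
have zN : z \in nbhd (@harary p q) x.
  rewrite inE /harary; apply/orP; left.
  apply/existsP; exists (Ordinal d0); rewrite /= modnDml -addnA subnK; last by lia.
  by rewrite modnDr [(x : nat) %% q]modn_small // eqxx orbT.
have neq : y != z.
  apply/eqP => /(congr1 val) /= /eqP.
  by rewrite eqn_modDl !modn_small; lia.
have sub : [set y; z] \subset nbhd (@harary p q) x.
  by apply/subsetP => t; rewrite in_set2 => /orP[] /eqP ->.
by have := subset_leq_card sub; rewrite cards2 neq.
Qed.

(* Main.v *)
Require Import Defs.
From mathcomp Require Import all_boot all_order all_algebra.
From mathcomp Require Import zify.

(* The lower bound counts edges leaving a double total dominating set: every
   vertex has degree 2m+1 except the vertex n, of degree 2m+2.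

   For the upper bounds, take points u_0 < ... < u_{N-1} around the circle with
   u_{j+2} - u_j <= 2m+1, so that every window of 2m+1 consecutive vertices
   contains two of them. This dominates the vertices outside the set; a vertex
   of the set still needs a second neighbor besides the one in its window,
   which is guaranteed either because all gaps are at most m or because its
   chord stays in the set. Equidistributed points floor(j p / d) satisfy these
   constraints, with
   - r <= 1: 2l+1 points in two translates by n of floor(j n / l); the translates
     share the vertex n;
   - r >= 2: 2l+2 points in two translates by n of floor(j (n+1) / (l+1));
   - l + r <= m: 2l+1 points floor(j (2n+1) / (2l+1)), with all gaps at most m. *)

Set Implicit Arguments.
Unset Strict Implicit.
Unset Printing Implicit Defensive.

(** * Lower bound by degree counting *)

(** Count the pairs of adjacent vertices [x] and [s] with [s] in [S] in two ways; each [x] occurs in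
    at least two of them. *)
Lemma double_total_dominating_sum_degree (T : finType) (e : rel T) (S : {set T}) :
  symmetric e -> double_total_dominating e S ->
  2 * #|T| <= \sum_(s in S) #|nbhd e s|.
Proof.
move=> syme /forallP dS.
have -> : \sum_(s in S) #|nbhd e s| = \sum_x #|nbhd e x :&: S|.
  under eq_bigr => s _ do rewrite -sum1dep_card.
  rewrite (exchange_big_dep predT) //=; apply: eq_bigr => x _.
  rewrite -sum1_card; apply: eq_bigl => s.
  by rewrite !inE andbC syme.
rewrite mulnC -sum_nat_const; exact: leq_sum.
Qed.

Lemma harary_degree (m n : nat) (x : 'I_(2 * n + 1)) :
  #|nbhd (@harary (2 * m + 1) (2 * n + 1)) x| <= 2 * m + 1 + (x == n :> nat).
Proof.
have q0 : 0 < 2 * n + 1 by lia.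
have lx := ltn_ord x.
pose pt a : 'I_(2 * n + 1) := Ordinal (ltn_pmod a q0).
pose R : {set 'I_(2 * n + 1)} := [set pt (x + k.+1) | k : 'I_m].
(* The [m] full turns keep the subtraction from truncating for every [k < m], even when [m] is large
   compared with [n]. *)
pose L : {set 'I_(2 * n + 1)} := [set pt (x + (2 * n + 1) * m - k.+1) | k : 'I_m].
(* The chord partner of [x] is [x + n] if [x <= n], and otherwise [x - n], which is [x + n + 1]
   modulo [2 * n + 1]. The vertex [n] lies on two chords, to [2 * n] and to [0]. *)
pose C : {set 'I_(2 * n + 1)} :=
  [set pt (x + n + (n < x))] :|: (if x == n :> nat then [set pt 0] else set0).
have sub : nbhd (@harary (2 * m + 1) (2 * n + 1)) x \subset (R :|: L) :|: C.
  apply/subsetP => y; rewrite inE => /or3P[/existsP[[k ltk] /=]||].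
  - have {}ltk : k < m by lia.
    case/orP=> /eqP E; rewrite !inE; apply/orP; left; apply/orP.
      by left; apply/imsetP; exists (Ordinal ltk) => //; apply: val_inj.
    right; apply/imsetP; exists (Ordinal ltk) => //; apply: val_inj => /=.
    rewrite E; have ly := ltn_ord y; have := divn_eq (y + k.+1) (2 * n + 1).
    set t := _ %/ _; set w := _ %% _ => D.
    have tm : t <= m by rewrite -ltnS ltn_divLR //; nia.
    have -> : w + (2 * n + 1) * m - k.+1 = (m - t) * (2 * n + 1) + y.
      by rewrite mulnBl; have := leq_mul tm (leqnn (2 * n + 1)); lia.
    by rewrite modnMDl modn_small.
  - case/andP=> xn /eqP E; rewrite !inE; apply/orP; right; apply/orP; left.
    by apply/eqP/val_inj; rewrite /= E; congr (_ %% _); lia.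
  - have ly := ltn_ord y; case/andP=> lyn /eqP E.
    have {}E : x = y + n :> nat by rewrite E modn_small; lia.
    have {}lyn : y <= n by lia.
    rewrite !inE; apply/orP; right; case: (ltngtP x n) => xn; first by lia.
      rewrite inE orbF; apply/eqP/val_inj => /=.
      have -> : x + n + true = 1 * (2 * n + 1) + y by lia.
      by rewrite modnMDl modn_small; lia.
    by rewrite inE; apply/orP; right; apply/eqP/val_inj; rewrite /= mod0n; lia.
apply: leq_trans (subset_leq_card sub) _.
apply: leq_trans (leq_card_setU _ _) _.
have cC : #|C| <= 1 + (x == n :> nat).
  apply: leq_trans (leq_card_setU _ _) _.
  by rewrite cards1; case: ifP; rewrite ?cards1 ?cards0.
have cR : #|R| <= m by rewrite (leq_trans (leq_imset_card _ _)) ?card_ord.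
have cL : #|L| <= m by rewrite (leq_trans (leq_imset_card _ _)) ?card_ord.
have [cRL _] := leq_card_setU R L.
by apply: leq_trans (leq_add cRL cC) _; lia.
Qed.

Lemma leq_double_total_domination_harary (m n : nat) :
  0 < m -> m < n ->
  4 * n + 1 <=
    (2 * m + 1) * double_total_domination (@harary (2 * m + 1) (2 * n + 1)).
Proof.
move=> m0 mn.
have deg2 x : 2 <= #|nbhd (@harary (2 * m + 1) (2 * n + 1)) x|.
  by apply: harary_min_degree; lia.
have [[S dS <-] _] := double_total_dominationP deg2.
have := double_total_dominating_sum_degree (@harary_sym _ _) dS.
rewrite card_ord => le1.
have le2 : \sum_(s in S) #|nbhd (@harary (2 * m + 1) (2 * n + 1)) s|
    <= \sum_(s in S) (2 * m + 1 + (s == n :> nat)).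
  by apply: leq_sum => s _; apply: harary_degree.
(* The exceptional vertex [n] costs at most 1, which turns [2 * (2 * n + 1)] into [4 * n + 1]. *)
have le3 : \sum_(s in S) (s == n :> nat) <= 1.
  have ltn' : n < 2 * n + 1 by lia.
  have -> : \sum_(s in S) (s == n :> nat) = \sum_(s in S | s == n :> nat) 1.
    by rewrite [RHS]big_mkcondr /=; apply: eq_bigr => s _; case: (_ == _).
  rewrite -[X in _ <= X](cards1 (Ordinal ltn')) sum1dep_card.
  apply: subset_leq_card; apply/subsetP => s; rewrite !inE => /andP[_ /eqP sn].
  by apply/eqP/val_inj.
rewrite big_split sum_nat_const /= in le2.
rewrite [_ * #|S|]mulnC -(leq_add2r 1).
by apply: (leq_trans _ (leq_trans (leq_trans le1 le2) (leq_add (leqnn _) le3))); lia.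
Qed.

(** * A criterion for point sequences around the circle *)

Lemma leq_card_nbhd2 (T : finType) (e : rel T) (S : {set T}) (x y z : T) :
  y != z -> y \in S -> z \in S -> e x y -> e x z -> 2 <= #|nbhd e x :&: S|.
Proof.
move=> neq yS zS xy xz.
have sub : [set y; z] \subset nbhd e x :&: S.
  by apply/subsetP => t; rewrite !inE => /orP[] /eqP ->; apply/andP.
by have := subset_leq_card sub; rewrite cards2 neq.
Qed.

Lemma eq_mod_window (q a b : nat) : a < b < a + q -> (a %% q == b %% q) = false.
Proof.
case/andP=> ab bq; rewrite eq_sym eqn_mod_dvd; last by lia.
by apply/negP => /dvdn_leq; lia.
Qed.

(** [z] is a lift of [y] to the integers, taken one turn up so that the window around [x] has no
    truncated subtraction. *)
Lemma harary_near (m n : nat) (x y : 'I_(2 * n + 1)) (z : nat) :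
  m < n -> y = z %% (2 * n + 1) :> nat -> z != x + (2 * n + 1) ->
  x + (2 * n + 1) - m <= z <= x + (2 * n + 1) + m ->
  harary (2 * m + 1) x y.
Proof.
move=> mn yz zx /andP[lez gez]; have lx := ltn_ord x.
apply/orP; left; case: (ltngtP z (x + (2 * n + 1))) zx => // zx _.
  have ltk : x + (2 * n + 1) - z - 1 < (2 * m + 1 - 1)./2 by lia.
  apply/existsP; exists (Ordinal ltk); apply/orP; right => /=.
  rewrite yz modnDml; apply/eqP.
  have -> : z + (x + (2 * n + 1) - z - 1).+1 = 1 * (2 * n + 1) + x by lia.
  by rewrite modnMDl modn_small.
have ltk : z - (x + (2 * n + 1)) - 1 < (2 * m + 1 - 1)./2 by lia.
apply/existsP; exists (Ordinal ltk); apply/orP; left => /=; rewrite yz.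
have -> : z = 1 * (2 * n + 1) + (x + (z - (x + (2 * n + 1)) - 1).+1) by lia.
rewrite modnMDl; apply/eqP; congr (_ %% _); lia.
Qed.

(** A chord spans [n] steps one way and [n + 1] the other, both more than [m]. So a chord neighbor
    always counts separately from a neighbor in the window. *)
Lemma harary_chord_far (m n : nat) (x y : 'I_(2 * n + 1)) (z : nat) :
  m < n -> harary_chord x y || harary_chord y x ->
  x + (2 * n + 1) - m <= z <= x + (2 * n + 1) + m ->
  (y == z %% (2 * n + 1) :> nat) = false.
Proof.
move=> mn xy /andP[lez gez]; have lx := ltn_ord x; have ly := ltn_ord y.
have [yx|xy'] : y = x + n :> nat \/ x = y + n :> nat.
  by case/orP: xy => /andP[le1 /eqP ->]; [left | right]; rewrite modn_small; lia.
  by rewrite -[y : nat](modn_small ly) eq_mod_window; lia.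
have -> : y = (1 * (2 * n + 1) + y) %% (2 * n + 1) :> nat.
  by rewrite modnMDl modn_small.
by rewrite eq_mod_window; lia.
Qed.

Lemma double_total_domination_harary_leq_sequence (m n N : nat) (u : nat -> nat) :
  0 < m -> m < n -> u 0 = 0 -> u N = 2 * n + 1 ->
  (forall j, j < N -> u j < u j.+1) ->
  (forall j, j.+1 < N -> u j.+2 <= u j + (2 * m + 1)) ->
  u 1 + (2 * n + 1) <= u N.-1 + (2 * m + 1) ->
  (forall j, j < N -> u j.+1 <= u j + m) \/
  (forall j, j < N -> exists2 i, i < N &
     u j <= n /\ u i = u j + n \/ u i <= n /\ u j = u i + n) ->
  double_total_domination (@harary (2 * m + 1) (2 * n + 1)) <= N.
Proof.
move=> m0 mn u0 uN uS uSS uwrap gap_or_chord.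
have q0 : 0 < 2 * n + 1 by lia.
have N0 : 0 < N by case: N uN {uS uSS uwrap gap_or_chord} => //; lia.
set q := 2 * n + 1 in uN uwrap q0 *.
pose pt a : 'I_q := Ordinal (ltn_pmod a q0).
pose S : {set 'I_q} := [set pt (u j) | j : 'I_N].
(* [s] winds [u] around the circle: [s (j + N) = s j + q]. *)
pose s j := j %/ N * q + u (j %% N).
have sE a b : b <= N -> s (a * N + b) = a * q + u b.
  rewrite leq_eqVlt => /orP[/eqP ->|ltb].
    rewrite -[X in _ + X]mul1n -mulnDl /s mulnK // modnMl u0 uN; lia.
  by rewrite /s divnMDl // modnMDl divn_small // modn_small // addn0.
have ptS j : pt (s j) \in S.
  apply/imsetP; exists (Ordinal (ltn_pmod j N0)) => //; apply: val_inj => /=.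
  by rewrite /s modnMDl.
have sS j : s j < s j.+1.
  rewrite (divn_eq j N) -addnS; have ltj := ltn_pmod j N0.
  by rewrite !sE ?ltn_add2l ?uS // ltnW.
have sSS j : s j.+2 <= s j + (2 * m + 1).
  rewrite (divn_eq j N) -!addnS; have ltj := ltn_pmod j N0.
  case: (ltnP (j %% N).+1 N) => ltj'.
    by rewrite !sE ?(ltnW ltj) // -addnA leq_add2l uSS.
  (* The two steps cross the start of the circle; this is what [uwrap] is for. *)
  have eN : (j %% N).+1 = N by lia.
  have -> : j %/ N * N + (j %% N).+2 = (j %/ N).+1 * N + 1 by rewrite mulSn; lia.
  have -> : j %% N = N.-1 by lia.
  by rewrite !sE; [rewrite mulSn; lia | lia | lia].
have chord : (forall j, s j.+1 <= s j + m) \/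
    (forall j, exists i, harary_chord (pt (s j)) (pt (s i))
                      || harary_chord (pt (s i)) (pt (s j))).
  case: gap_or_chord => [gap|ch]; [left | right] => j.
    rewrite (divn_eq j N) -addnS; have ltj := ltn_pmod j N0.
    by rewrite !sE -?addnA ?leq_add2l ?gap // ltnW.
  have [i ltiN H] := ch _ (ltn_pmod j N0); exists i.
  have luq k : k < N -> u k < q.
    move=> ltk; suff H' d : k + d.+1 <= N -> u k < u (k + d.+1).
      have := H' (N - k.+1); rewrite (_ : k + _ = N); last by lia.
      by rewrite uN; apply.
    elim: d => [|d IH] led; first by rewrite addn1 uS.
    by rewrite (ltn_trans (IH _)) ?[k + d.+2]addnS ?uS //; lia.
  have si : s i = u i by rewrite -[i]/(0 * N + i) sE // ltnW.
  have lti := luq _ ltiN; have ltj := luq _ (ltn_pmod j N0).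
  have n2 : (q - 1)./2 = n by rewrite /q; lia.
  rewrite /harary_chord /= n2 si /s modnMDl !(modn_small lti) !(modn_small ltj).
  by case: H => [[le1 e]|[le1 e]]; apply/orP; [left|right];
    rewrite le1 -e ?(modn_small lti) ?(modn_small ltj) eqxx.
have dS : double_total_dominating (@harary (2 * m + 1) q) S.
  apply/forallP => x; have lx := ltn_ord x.
  have j_le j : j <= s j by elim: j => [//|j IH]; apply: leq_ltn_trans (sS j).
  (* Take the last [j] with [s j] left of the window around [x]. Two steps advance by at most
     [2 * m + 1], so [s j.+1] and [s j.+2] both lie in the window; they suffice unless one of them
     is [x] itself. *)
  have exP : exists j, s j < x + q - m.
    by exists 0; rewrite /s mod0n div0n u0 /q; lia.
  have ubP j : s j < x + q - m -> j <= x + q.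
    by move=> lt; have := j_le j; lia.
  have [j ltj maxj] := ex_maxnP exP ubP.
  have gej : x + q - m <= s j.+1.
    by rewrite leqNgt; apply/negP => /maxj; rewrite ltnn.
  have := sS j; have := sS j.+1; have := sSS j; have := sSS j.+1 => h1 h2 h3 h4.
  have near z : z != x + q -> x + q - m <= z <= x + q + m ->
      harary (2 * m + 1) x (pt z).
    by move=> zx zw; apply: (@harary_near m n x (pt z) z).
  have nept a b : a < b < a + q -> pt a != pt b.
    move=> ab; apply/eqP => /(congr1 val) /= /eqP.
    by rewrite eq_mod_window.
  have qE : q = 2 * n + 1 by [].
  have ptx k : s k = x + q -> pt (s k) = x.
    move=> e; apply: val_inj => /=; rewrite e -[X in (_ + X) %% _]mul1n addnC.
    by rewrite modnMDl modn_small.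
  have viachord k l : s k = x + q -> (forall j, exists i,
        harary_chord (pt (s j)) (pt (s i)) || harary_chord (pt (s i)) (pt (s j))) ->
      s l != x + q -> x + q - m <= s l <= x + q + m ->
      2 <= #|nbhd (@harary (2 * m + 1) q) x :&: S|.
    move=> sk ch slx slw; have [i xi] := ch k; rewrite ptx // in xi.
    apply: (@leq_card_nbhd2 _ _ _ _ (pt (s i)) (pt (s l))) => //; last exact: near.
      by rewrite -val_eqE /= (@harary_chord_far m n x (pt (s i)) (s l)).
    by rewrite /harary; apply/orP; right.
  case: (eqVneq (s j.+1) (x + q)) => [e1|e1].
    case: chord => [gap|ch].
      (* With gaps at most [m], [s j] would already be in the window, against the choice of [j]: the
         case is vacuous and [lia] closes it by contradiction. *)
      have := gap j; have := gap j.+1 => g1 g2.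
      apply: (@leq_card_nbhd2 _ _ _ _ (pt (s j)) (pt (s j.+2))) => //.
      - by apply: nept; lia.
      - by apply: near; lia.
      - by apply: near; lia.
    by apply: (viachord j.+1 j.+2) => //; lia.
  case: (eqVneq (s j.+2) (x + q)) => [e2|e2].
    case: chord => [gap|ch].
      have := gap j.+2; have := sS j.+2 => g1 g2.
      apply: (@leq_card_nbhd2 _ _ _ _ (pt (s j.+1)) (pt (s j.+3))) => //.
      - by apply: nept; lia.
      - by apply: near; lia.
      - by apply: near; lia.
    by apply: (viachord j.+2 j.+1) => //; lia.
  apply: (@leq_card_nbhd2 _ _ _ _ (pt (s j.+1)) (pt (s j.+2))) => //.
  - by apply: nept; lia.
  - by apply: near; lia.
  - by apply: near; lia.
have deg2 x : 2 <= #|nbhd (@harary (2 * m + 1) q) x|.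
  by apply: harary_min_degree; lia.
have [_ minS] := double_total_dominationP deg2.
apply: leq_trans (minS _ dS) _.
by rewrite (leq_trans (leq_imset_card _ _)) ?card_ord.
Qed.

(** * Upper bounds from equidistributed points *)

Lemma leq_floor_add (p d i e k : nat) : 0 < d -> e * p <= k * d ->
  (i + e) * p %/ d <= i * p %/ d + k.
Proof.
move=> d0 le; rewrite [X in _ <= X]addnC -divnMDl // mulnDl addnC.
by rewrite leq_div2r // leq_add2r.
Qed.

Lemma geq_floor_add (p d i e k : nat) : 0 < d -> k * d <= e * p ->
  i * p %/ d + k <= (i + e) * p %/ d.
Proof.
move=> d0 le; rewrite [X in X <= _]addnC -divnMDl // mulnDl [i * p + _]addnC.
by rewrite leq_div2r // leq_add2r.
Qed.

(** The points are [t 0, ..., t (2 * l) = 2 * n], and index [2 * l + 1] closes the turn by a gap of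
    1. Since [t (j + l) = t j + n], chords pair the indices [j] and [j + l]. *)
Lemma double_total_domination_harary_leq_odd (m n l : nat) :
  0 < m -> m < n -> 0 < l <= n -> 2 * n <= (2 * m + 1) * l ->
  double_total_domination (@harary (2 * m + 1) (2 * n + 1)) <= 2 * l + 1.
Proof.
move=> m0 mn /andP[l0 ln] le2.
pose t j := j * n %/ l.
have tS j : t j < t j.+1 by rewrite -addn1 -[j.+1]addn1 geq_floor_add //; lia.
(* Leaves room for the closing gap of 1 in the last two-step gap and in the one that wraps. *)
have tS' j : t j.+1 <= t j + 2 * m by rewrite -addn1 leq_floor_add //; nia.
have tSS j : t j.+2 <= t j + (2 * m + 1) by rewrite -addn2 leq_floor_add //; lia.
have t0 : t 0 = 0 by rewrite /t mul0n div0n.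
have tl j : t (j + l) = t j + n.
  by rewrite /t mulnDl [l * n]mulnC addnC divnMDl // addnC.
have t2l : t (2 * l) = 2 * n by rewrite -[2 * l]add0n mul2n -addnn addnA !tl t0; lia.
have mono j : j <= l -> t j <= n.
  by move=> le; rewrite -[n]add0n -t0 -tl leq_div2r // leq_mul2r le orbT.
apply: (@double_total_domination_harary_leq_sequence m n (2 * l + 1)
          (fun j => if j <= 2 * l then t j else 2 * n + 1)) => //=.
- by rewrite ifF //; lia.
- move=> j ltj; rewrite ifT; last by lia.
  case: ifP => // lt; have -> : j = 2 * l by lia.
  by rewrite t2l; lia.
- move=> j ltj; rewrite (ifT _ _ (_ : j <= 2 * l)); last by lia.
  case: ifP => // lt; have := tS' j; have -> : j.+1 = 2 * l by lia.
  by rewrite t2l; lia.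
- rewrite ifT; last by lia.
  rewrite ifT; last by lia.
  have := tS' 0; rewrite t0; have -> : (2 * l + 1).-1 = 2 * l by lia.
  by rewrite t2l; lia.
- right=> j ltj; case: (leqP j l) => le.
    exists (j + l); first by lia.
    left; split; first by rewrite ifT; [apply: mono | lia].
    by rewrite !ifT; [rewrite tl | lia | lia].
  exists (j - l); first by lia.
  right; split; first by rewrite ifT; [apply: mono; lia | lia].
  by rewrite !ifT; [rewrite -tl subnK //; lia | lia | lia].
Qed.

(** Here [t (j + d) = t j + (n + 1)]; lowering the second half by 1 makes it the translate of the
    first by [n], so chords pair [j] with [j + d], and makes the turn close at [2 * n + 1]. *)
Lemma double_total_domination_harary_leq_even (m n d : nat) :
  0 < m -> m < n -> 1 < d <= n -> 2 * (n + 1) <= (2 * m + 1) * d ->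
  double_total_domination (@harary (2 * m + 1) (2 * n + 1)) <= 2 * d.
Proof.
move=> m0 mn /andP[d1 dn] le2; have d0 : 0 < d by lia.
pose t j := j * (n + 1) %/ d.
have tS j : t j < t j.+1 by rewrite -addn1 -[j.+1]addn1 geq_floor_add //; lia.
have tSS j : t j.+2 <= t j + (2 * m + 1) by rewrite -addn2 leq_floor_add //; lia.
have t0 : t 0 = 0 by rewrite /t mul0n div0n.
have tD j : t (j + d) = t j + (n + 1).
  by rewrite /t mulnDl [d * _]mulnC addnC divnMDl // addnC.
have td : t d = n + 1 by rewrite -[d]add0n tD t0.
(* The lowered point at index [d] is [n], so strict increase there needs a gap of at least 2 before
   it; [d <= n] provides it. *)
have td1 : t d.-1 < n.
  rewrite /t ltn_divLR //.
  by case: d d1 dn {le2 d0 t tS tSS t0 tD td} => //; nia.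
have t2d : t (2 * d) = 2 * (n + 1).
  by rewrite mul2n -addnn tD td; lia.
have homo i j : i <= j -> t i <= t j.
  by move=> le; rewrite leq_div2r // leq_mul2r le orbT.
apply: (@double_total_domination_harary_leq_sequence m n (2 * d)
          (fun j => t j - (d <= j))) => //=.
- by rewrite t0.
- by rewrite t2d; lia.
- move=> j _; have := tS j; have := homo d j.
  case: (eqVneq d j.+1) => [ej|]; last by lia.
  by have jE : j = d.-1; [lia | rewrite -ej td jE; lia].
- by move=> j _; have := tSS j; have := homo d j; rewrite td; lia.
- have := tSS (2 * d).-1; have -> : (2 * d).-1.+2 = 1 + d + d by lia.
  by rewrite !tD; have := homo d (2 * d).-1; lia.
- right=> j ltj; case: (ltnP j d) => le.
    exists (j + d); first by lia.
    left; split; first by have := homo j d.-1; lia.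
    by rewrite tD leq_addl; lia.
  exists (j - d); first by lia.
  have := tD (j - d); rewrite subnK // => ->.
  have := homo (j - d) d.-1.
  by right; have -> : (d <= j - d) = false; lia.
Qed.

Lemma double_total_domination_harary_leq_dense (m n N : nat) :
  0 < m -> m < n -> 1 < N <= 2 * n + 1 -> 2 * n + 1 <= m * N ->
  double_total_domination (@harary (2 * m + 1) (2 * n + 1)) <= N.
Proof.
move=> m0 mn /andP[N1 Nq] le; have N0 : 0 < N by lia.
pose t j := j * (2 * n + 1) %/ N.
have tS j : t j < t j.+1 by rewrite -addn1 -[j.+1]addn1 geq_floor_add //; lia.
have tS' j : t j.+1 <= t j + m by rewrite -addn1 leq_floor_add //; lia.
have t0 : t 0 = 0 by rewrite /t mul0n div0n.
have tN : t N = 2 * n + 1 by rewrite /t mulKn.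
apply: (@double_total_domination_harary_leq_sequence m n N t) => //.
- by move=> j _; have := tS' j; have := tS' j.+1; lia.
- have := tS' 0; have := tS' N.-1; rewrite prednK // t0 tN; lia.
- by left.
Qed.

(** * Comparison with the ceiling *)

Lemma ceil_divn_le (a b g : nat) : 0 < b ->
  (Num.ceil (a%:Q / b%:Q) <= g%:Z)%R = (a <= g * b).
Proof.
move=> b0; rewrite Num.Theory.ceil_le_int Num.Theory.ler_pdivrMr.
  by rewrite -!pmulrn -GRing.natrM Num.Theory.ler_nat.
by rewrite -pmulrn Num.Theory.ltr0n.
Qed.

Theorem theorem2p4 (m n l r l' r' : nat)
    (m_gt0 : 0 < m) (n_gt0 : 0 < n) (ltmn : 2 * m + 1 < 2 * n + 1)
    (divq : 2 * n + 1 = (2 * m + 1) * l + r) (r_le : r <= 2 * m) (l_ge1 : 1 <= l)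
    (divlr : l + r = 2 * m * l' + r') (r'_lt : r' < 2 * m) :
  let gamma := double_total_domination (@harary (2 * m + 1) (2 * n + 1)) in
  let c := Num.ceil ((4 * n + 1)%N%:Q / (2 * m + 1)%N%:Q)%R in
  let special :=
    ([/\ 2 <= r <= m, 1 <= r' <= m & l' = 0] \/
     (r = 1 \/ m + 2 <= r <= 2 * m)) in
  (special -> gamma%:Z%R = c) /\
  (~ special -> (c <= gamma%:Z <= c + 1)%R).
Proof.
move=> gamma c special.
have mn : m < n by lia.
have k0 : 0 < 2 * m + 1 by lia.
have cP g : (c <= g%:Z)%R = (4 * n + 1 <= g * (2 * m + 1)) by apply: ceil_divn_le.
have c_le : (c <= gamma%:Z)%R.
  by rewrite cP [X in _ <= X]mulnC; apply: leq_double_total_domination_harary.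
have c_ge N : gamma <= N.+1 -> N * (2 * m + 1) < 4 * n + 1 -> (gamma%:Z <= c)%R.
  by rewrite ltnNge -cP -Order.TotalTheory.ltNge => le lt; lia.
have upper_odd : r <= 1 -> gamma <= 2 * l + 1.
  by move=> r1; apply: double_total_domination_harary_leq_odd; nia.
have upper_even : 2 <= r -> gamma <= 2 * l + 2.
  move=> r2; have -> : 2 * l + 2 = 2 * l.+1 by lia.
  by apply: double_total_domination_harary_leq_even; nia.
(* For [N = 2 * l + 1], the condition [2 * n + 1 <= m * N] reads [l + r <= m]. *)
have upper_dense : l + r <= m -> gamma <= 2 * l + 1.
  by move=> lrm; apply: double_total_domination_harary_leq_dense; nia.
(* Everything rests on [4 * n + 1 + 1 = 2 * l * (2 * m + 1) + 2 * r]. For [r >= 1] this gives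
   [c > 2 * l], and for [r >= m + 2] even [c > 2 * l + 1]. In the first special case [l' = 0] makes
   [l + r = r' <= m]. *)
split=> [sp|nsp].
  have gec : (gamma%:Z <= c)%R.
    case: sp => [[r2m r'm l'0]|[r1|rm]].
    - by apply: (c_ge (2 * l)); [have := upper_dense; lia | lia].
    - by apply: (c_ge (2 * l)); [have := upper_odd; lia | lia].
    - by apply: (c_ge (2 * l).+1); [have := upper_even; lia | lia].
  by lia.
have r1 : r <> 1 by move=> e; apply: nsp; right; left.
rewrite c_le /=.
have c_gt N : N * (2 * m + 1) < 4 * n + 1 -> (N%:Z < c)%R.
  by rewrite ltnNge -cP Order.TotalTheory.ltNge.
(* As [r] is not 1, the first case is [r = 0], where [c] is only known to exceed [2 * l - 1]. *)
case: (ltnP r 2) => r2.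
  by have := c_gt (2 * l - 1); have := upper_odd; nia.
by have := c_gt (2 * l); have := upper_even r2; lia.
Qed.
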